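(* Let $X$ be a non-negative absolutely continuous random variable with probability density function $f$ and let $\omega\ge0$ be a weight function. For any real number $\beta\ge1$, $$\left(I_{\frac{\beta+1}{2}}^{\sqrt{\omega}}(X)\right)^2\le I_\beta^\omega(X)\le\sqrt{I_{2\beta-1}^{\omega^2}(X)}.$$
   Context: For a non-negative absolutely continuous random variable $X$ with density $f$, a measurable weight $\omega\ge0$ and order $p\ge1$, the general weighted information generating function (GWIGF) is $I_p^\omega(X)=\int_0^\infty \omega(u)f^p(u)\,du$; $I_p^{\sqrt\omega}$ and $I_p^{\omega^2}$ denote the same quantity with weights $\sqrt{\omega(u)}$ and $\omega(u)^2$. All integrals appearing are assumed to exist. *)

(* Defs.v *)
From HB Require Import structures.
From mathcomp Require Import all_boot all_order all_algebra.
From mathcomp Require Import all_classical all_reals all_analysis.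

Set Implicit Arguments.
Unset Strict Implicit.
Unset Printing Implicit Defensive.

Import Order.TTheory GRing.Theory Num.Theory.
Import numFieldNormedType.Exports.

Local Open Scope classical_set_scope.
Local Open Scope ring_scope.

(* Having a density entails that the law of [X] is absolutely continuous with
   respect to the Lebesgue measure. *)
Definition has_density (R : realType) (d : measure_display)
    (T : measurableType d) (P : probability T R) (X : {RV P >-> R})
    (f : R -> R) : Prop :=
  [/\ measurable_fun setT f,
      forall x, 0 <= f x
    & forall A : set R, measurable A ->
        distribution P X A = (\int[lebesgue_measure]_(x in A) (f x)%:E)%E].

Definition gwigf_integrand (R : realType) (f w : R -> R) (p : R) : R -> R :=
  fun u => w u * f u `^ p.

(* [I_p^w(X)] depends on [X] only through its density [f]. [Rintegral] is real
   valued and returns 0 on a divergent integral, hence [GWIGF_exists]. *)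
Definition GWIGF (R : realType) (f w : R -> R) (p : R) : R :=
  \int[lebesgue_measure]_(u in `[0, +oo[) gwigf_integrand f w p u.

Definition GWIGF_exists (R : realType) (f w : R -> R) (p : R) : Prop :=
  lebesgue_measure.-integrable `[0, +oo[ (EFin \o gwigf_integrand f w p).

(* Main.v *)
Require Import Defs.
From HB Require Import structures.
From mathcomp Require Import all_boot all_order all_algebra.
From mathcomp Require Import all_classical all_reals all_analysis.
From mathcomp Require Import ring lra.

Set Implicit Arguments.
Unset Strict Implicit.
Unset Printing Implicit Defensive.

Import Order.TTheory GRing.Theory Num.Theory.
Import numFieldNormedType.Exports.

Local Open Scope classical_set_scope.
Local Open Scope ring_scope.

(** Both bounds are Cauchy-Schwarz against the density, whose mass on the
    half-line is at most 1: if [u^2 <= v f] then [(∫ u)^2 <= (∫ v)(∫ f) <= ∫ v].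
    Take [u = sqrt w f^((beta+1)/2)], [v = w f^beta] for the first bound, and
    [u = w f^beta], [v = w^2 f^(2 beta - 1)] for the second. Cauchy-Schwarz
    itself comes from integrating [2 a u <= v + a^2 f] with [a = ∫ u]. *)

Lemma sqr_Rintegral_le (d : measure_display) (T : measurableType d)
    (R : realType) (mu : {measure set T -> \bar R}) (D : set T)
    (u v f : T -> R) :
  measurable D ->
  mu.-integrable D (EFin \o u) -> mu.-integrable D (EFin \o v) ->
  mu.-integrable D (EFin \o f) ->
  (forall x, D x -> 0 <= v x) -> (forall x, D x -> 0 <= f x) ->
  (forall x, D x -> u x ^+ 2 <= v x * f x) ->
  \int[mu]_(x in D) f x <= 1 ->
  (\int[mu]_(x in D) u x) ^+ 2 <= \int[mu]_(x in D) v x.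
Proof.
move=> mD iu iv i_f v0 f0 uvf f1; set a := \int[mu]_(x in D) u x.
have iZ (k : R) g : mu.-integrable D (EFin \o g) ->
    mu.-integrable D (EFin \o (fun x => k * g x)).
  by move=> ig; exact: (integrableZl mD k ig).
have : \int[mu]_(x in D) (2 * a * u x)
    <= \int[mu]_(x in D) (v x + a ^+ 2 * f x).
  apply: le_Rintegral => //; first exact: iZ.
    exact: (integrableD mD iv (iZ _ _ i_f)).
  move=> x Dx; have := uvf _ Dx; have := v0 _ Dx; have := f0 _ Dx.
  (* [(2 a u)^2 <= 4 a^2 v f <= (v + a^2 f)^2] by AM-GM. *)
  move=> fx0 vx0 ux; have a0 := sqr_ge0 a.
  have y0 : 0 <= v x + a ^+ 2 * f x by rewrite addr_ge0// mulr_ge0.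
  rewrite (le_trans (ler_norm _))// -ler_sqr ?nnegrE// real_normK ?num_real//.
  have := sqr_ge0 (v x - a ^+ 2 * f x).
  have := ler_wpM2l a0 ux; lra.
rewrite RintegralZl// RintegralD//; last exact: iZ.
(* The integrated inequality reads [2 * a ^+ 2 <= ∫ v + a ^+ 2 * ∫ f]; as [∫ f <= 1], one [a ^+ 2]
   cancels. *)
rewrite RintegralZl// -/a; have := ler_wpM2l (sqr_ge0 a) f1; lra.
Qed.

(** Since [f] is nonnegative, the integral of its absolute value over [D] is the probability that
    [X] lies in [D], hence finite. *)
Lemma density_integrable (R : realType) (d : measure_display)
    (T : measurableType d) (P : probability T R) (X : {RV P >-> R})
    (f : R -> R) (D : set R) :
  measurable D -> has_density X f ->
  lebesgue_measure.-integrable D (EFin \o f).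
Proof.
move=> mD [mf f0 dens]; apply/integrableP; split.
  by apply/measurable_realfun.measurable_EFinP; exact: measurable_funTS.
under eq_integral do rewrite gee0_abs ?lee_fin ?f0//.
by rewrite -dens// (le_lt_trans (probability_le1 _ mD)) ?ltry.
Qed.

Lemma Rintegral_density_le1 (R : realType) (d : measure_display)
    (T : measurableType d) (P : probability T R) (X : {RV P >-> R})
    (f : R -> R) (D : set R) :
  measurable D -> has_density X f ->
  \int[lebesgue_measure]_(x in D) f x <= 1.
Proof.
move=> mD [_ _ dens]; rewrite /Rintegral -dens// -lee_fin fineK.
  exact: probability_le1.
exact: fin_num_measure.
Qed.

Theorem theorem2p1 (R : realType) (d : measure_display) (T : measurableType d)
    (P : probability T R) (X : {RV P >-> R}) (f w : R -> R) (beta : R)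
    (X_ge0 : {ae P, forall t, 0 <= X t})
    (X_density : has_density X f)
    (w_measurable : measurable_fun (`[0, +oo[ : set R) w)
    (w_ge0 : forall u, 0 <= u -> 0 <= w u)
    (beta_ge1 : 1 <= beta)
    (exists_sqrt : GWIGF_exists f (fun u => Num.sqrt (w u)) ((beta + 1) / 2))
    (exists_beta : GWIGF_exists f w beta)
    (exists_sqr : GWIGF_exists f (fun u => w u ^+ 2) (2 * beta - 1)) :
  (GWIGF f (fun u => Num.sqrt (w u)) ((beta + 1) / 2)) ^+ 2 <= GWIGF f w beta
  /\ GWIGF f w beta <= Num.sqrt (GWIGF f (fun u => w u ^+ 2) (2 * beta - 1)).
Proof.
have mD : measurable (`[0, +oo[ : set R) by exact: measurable_itv.
have f_ge0 u : 0 <= f u by case: X_density.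
have f_int := density_integrable mD X_density.
have f_le1 := Rintegral_density_le1 mD X_density.
have w0 u : `[0, +oo[%classic u -> 0 <= w u.
  by rewrite /= in_itv/= andbT; exact: w_ge0.
have powD r s u : 0 < r + s -> f u `^ (r + s) = f u `^ r * f u `^ s.
  by move=> rs0; rewrite powRD// gt_eqF.
rewrite /GWIGF; split.
- apply: (sqr_Rintegral_le _ exists_sqrt exists_beta f_int) => // u Du.
    by rewrite mulr_ge0 ?powR_ge0 ?w0.
  rewrite /gwigf_integrand exprMn sqr_sqrtr ?w0// expr2 -powD; last by lra.
  (* The lone density factor becomes [f u]^ 1[; both sides are then]w u * f u [^ (beta + 1)]. *)
  rewrite -mulrA -{3}(powRr1 (f_ge0 u)) -powD; last by lra.
  by rewrite (_ : (beta + 1) / 2 + (beta + 1) / 2 = beta + 1)//; field.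
(* Writing [|I|] as the square root of [I ^+ 2] reduces the bound to one on squares, without a
   separate sign argument for [I]. *)
- apply: (le_trans (ler_norm _)); rewrite -sqrtr_sqr ler_wsqrtr//.
  apply: (sqr_Rintegral_le _ exists_beta exists_sqr f_int) => // u Du.
    by rewrite mulr_ge0 ?powR_ge0 ?sqr_ge0.
  rewrite /gwigf_integrand exprMn [f u `^ _ ^+ 2]expr2 -powD; last by lra.
  rewrite -mulrA -{3}(powRr1 (f_ge0 u)) -powD; last by lra.
  by rewrite (_ : 2 * beta - 1 + 1 = beta + beta)//; ring.
Qed.
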